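(* Let $\mathcal{K}$ be a Kripke structure, let $\pi_1,\ldots,\pi_n$ be trace variables, and let $\psi$ be an admissible formula over $\pi_1,\ldots,\pi_n$ whose phase formula $\psi_{\mathit{ph}}$ occurs with positive polarity. Then $\mathcal{K}\models \exists\pi_1\ldots\exists\pi_n.\,\mathsf{E}.\,\psi$ (in the asynchronous semantics) if and only if $\mathcal{K}^{\mathit{st}}\models \exists\pi_1\ldots\exists\pi_n.\,\psi_{\mathit{esync}}$ (in the synchronous HyperLTL semantics), where $\psi_{\mathit{esync}}=\mathit{fair}\wedge\psi[\psi_{\mathit{ph}}\triangleleft(\Box\mathit{phase}\wedge\psi_{\mathit{ph}})]$.
   Context: Let $\mathsf{AP}$ be a set of atomic propositions and $\Sigma=2^{\mathsf{AP}}$. A trace is an infinite sequence $\sigma\in\Sigma^\omega$. A Kripke structure is $\mathcal{K}=\langle S,S_{\mathit{init}},\delta,L\rangle$ with states $S$, initial states $S_{\mathit{init}}\subseteq S$, transition relation $\delta\subseteq S\times S$ in which every state has a successor, and labeling $L:S\to\Sigma$. A path is an infinite sequence $s(0)s(1)\cdots$ with $s(0)\in S_{\mathit{init}}$ and $(s(i),s(i+1))\in\delta$; its trace is $L(s(0))L(s(1))\cdots$; $\mathsf{Traces}(\mathcal{K})$ is the set of these traces. Two traces $\sigma,\sigma'$ are stuttering equivalent if there are index sequences $0=i_0<i_1<\cdots$ and $0=j_0<j_1<\cdots$ with $\sigma(l)=\sigma'(l')$ for all $k$, $l\in[i_k,i_{k+1})$, $l'\in[j_k,j_{k+1})$. A-HLTL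 syntax: $\varphi::=\exists\pi.\varphi\mid\forall\pi.\varphi\mid\mathsf{E}\psi\mid\mathsf{A}\psi$, $\psi::=a_\pi\mid\neg\psi\mid\psi\vee\psi\mid\psi\,\mathcal{U}\,\psi\mid\bigcirc\psi$ ($a\in\mathsf{AP}$, $\pi$ a trace variable), with the usual abbreviations $\wedge,\to,\leftrightarrow,\mathit{true},\Diamond,\Box$. Pointed traces $(\sigma,p)$, trace assignments $\Pi$ (partial maps from trace variables to pointed traces). A trajectory over a set $V$ of trace variables is an infinite sequence $t$ of nonempty subsets of $V$; it is fair if each $\pi\in V$ occurs in infinitely many $t(j)$. $(\Pi,t)+1=(\Pi',t(1)t(2)\cdots)$ where $\Pi'(\pi)=(\sigma,p+1)$ if $\pi\in t(0)$ and $\Pi(\pi)=(\sigma,p)$, else $\Pi'(\pi)=\Pi(\pi)$; $(\Pi,t)+k$ iterates. Semantics over a trace set $T$: quantifiers $\exists\pi$/$\forall\pi$ bind $\pi$ to $(\sigma,0)$ for some/all $\sigma\in T$; $\Pi\models_T\mathsf{E}\psi$ (resp. $\mathsf{A}\psi$) iff $(\Pi,t)\models\psi$ for some (resp. all) fair trajectories $t$ over $\mathrm{Dom}(\Pi)$; $(\Pi,t)\models a_\pi$ iff $a\in\sigma(p)$ where $\Pi(\pi)=(\sigma,p)$; Boolean connectives as usual; $(\Pi,t)\models\bigcirc\psi$ iff $(\Pi,t)+1\models\psi$; $(\Pi,t)\models\psi_1\mathcal{U}\psi_2$ iff for some $i\ge0$, $(\Pi,t)+i\models\psi_2$ and $(\Pi,t)+j\models\psi_1$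 for all $j<i$. $\mathcal{K}\models\varphi$ iff the empty assignment satisfies $\varphi$ w.r.t. $\mathsf{Traces}(\mathcal{K})$. HyperLTL (synchronous) formulas are $\mathbb{Q}_1\pi_1\ldots\mathbb{Q}_n\pi_n.\psi$ evaluated with all pointers advancing together (the fixed trajectory $t(k)=\mathrm{Dom}(\Pi)$). Admissible formulas: a state formula is a Boolean combination of atoms; a monadic temporal formula is a $\psi$-formula whose atoms mention only one trace variable and whose LTL truth value is invariant under stuttering equivalence. An atomic phase formula is $\bigwedge_{p\in P}(p_{\pi_i}\leftrightarrow p_{\pi_j})$ with $P\subseteq\mathsf{AP}$, $\pi_i\ne\pi_j$, identified with $(\pi_i,\pi_j,P)$. A phase formula is $\psi_{\mathit{ph}}=\Box\big(\bigwedge_{k=1}^m\bigwedge_{p\in P^k}(p_{\pi^k_i}\leftrightarrow p_{\pi^k_j})\big)$ with characterization $\mathcal{P}=\{(\pi^k_i,\pi^k_j,P^k)\}_k$. An admissible formula is a Boolean combination of state formulas, monadic temporal formulas and exactly one occurrence of a phase formula $\psi_{\mathit{ph}}$; $\psi[\psi_{\mathit{ph}}\triangleleft\xi]$ replaces that occurrence by $\xi$. Positive polarity: the occurrence is under an even number of negations. Stuttering structure: with a fresh proposition $\mathit{st}$, $\mathcal{K}^{\mathit{st}}=\langle S\cup\{s^{\mathit{st}}\mid s\in S\},S_{\mathit{init}},\delta^{\mathit{st}},L^{\mathit{st}}\rangle$, $\delta^{\mathit{st}}=\delta\cup\{(s,s^{\mathit{st}}),(s^{\mathit{st}},s^{\mathit{st}})\mid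 s\in S\}\cup\{(s^{\mathit{st}},s')\mid(s,s')\in\delta\}$, $L^{\mathit{st}}(s)=L(s)$, $L^{\mathit{st}}(s^{\mathit{st}})=L(s)\cup\{\mathit{st}\}$. Formulas: $\mathit{change}_P(\pi_i)=\bigvee_{p\in P}\big(p_{\pi_i}\not\leftrightarrow\bigcirc(\mathit{st}_{\pi_i}\mathcal{U}p_{\pi_i})\big)$; $\mathit{move}(\pi_i)=\bigcirc\neg\mathit{st}_{\pi_i}$; $\mathit{align}_{(\pi_i,\pi_j,P)}=\big((\mathit{move}(\pi_i)\wedge\mathit{move}(\pi_j))\to(\mathit{change}_P(\pi_i)\leftrightarrow\mathit{change}_P(\pi_j))\big)\wedge\big((\mathit{move}(\pi_i)\wedge\neg\mathit{move}(\pi_j))\to\neg\mathit{change}_P(\pi_i)\big)\wedge\big((\neg\mathit{move}(\pi_i)\wedge\mathit{move}(\pi_j))\to\neg\mathit{change}_P(\pi_j)\big)$; $\mathit{phase}=\bigwedge_{(\pi_i,\pi_j,P)\in\mathcal{P}}\mathit{align}_{(\pi_i,\pi_j,P)}$; $\mathit{fair}=\bigwedge_{i=1}^n\Box\Diamond\neg\mathit{st}_{\pi_i}$. *)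

(* Defs.v *)
From mathcomp Require Import all_boot finmap boolp classical_sets.

Set Implicit Arguments.
Unset Strict Implicit.
Unset Printing Implicit Defensive.

Local Open Scope fset_scope.
Local Open Scope classical_set_scope.

Definition trace (AP : Type) := nat -> set AP.

Record kripke (AP : Type) := Kripke {
  state : Type;
  init : set state;
  trans : state -> state -> Prop;
  label : state -> set AP;
  trans_total : forall s, exists s', trans s s' }.

Definition path_of AP (K : kripke AP) (s : nat -> state K) : Prop :=
  init (s 0) /\ forall i, trans (s i) (s i.+1).

Definition traces AP (K : kripke AP) : set (trace AP) :=
  [set sigma | exists2 s : nat -> state K,
     path_of s & sigma = (fun i => label (s i))].

Definition stutter_equiv AP (sigma sigma' : trace AP) : Prop :=
  exists i j : nat -> nat,
    [/\ i 0 = 0 /\ (forall k, i k < i k.+1),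
        j 0 = 0 /\ (forall k, j k < j k.+1)
      & forall k l l', i k <= l < i k.+1 -> j k <= l' < j k.+1 ->
          sigma l = sigma' l'].

(* The constant FTrue is primitive: the abbreviation a \/ ~ a would need a
   designated proposition and trace variable, and empty conjunctions occur. *)
Inductive formula (AP Var : Type) :=
| FTrue
| FAtom of AP & Var
| FNot of formula AP Var
| FOr of formula AP Var & formula AP Var
| FUntil of formula AP Var & formula AP Var
| FNext of formula AP Var.

Arguments FTrue {AP Var}.

Section Abbreviations.
Variables AP Var : Type.
Implicit Types f g : formula AP Var.

Definition FFalse : formula AP Var := FNot FTrue.
Definition FAnd f g := FNot (FOr (FNot f) (FNot g)).
Definition FImp f g := FOr (FNot f) g.
Definition FIff f g := FAnd (FImp f g) (FImp g f).
Definition FEventually f := FUntil FTrue f.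
Definition FAlways f := FNot (FEventually (FNot f)).

End Abbreviations.

Arguments FFalse {AP Var}.

Section TemporalSemantics.
Variables (AP : Type) (Var : eqType).

Definition pointed_trace := (trace AP * nat)%type.
Definition assignment := Var -> option pointed_trace.
Definition trajectory := nat -> set Var.

Definition empty_assignment : assignment := fun=> None.

Definition bind (Pi : assignment) (x : Var) (sigma : trace AP) : assignment :=
  fun y => if y == x then Some (sigma, 0) else Pi y.

Definition dom (Pi : assignment) : set Var := [set x | Pi x <> None].

Definition trajectory_over (V : set Var) (t : trajectory) : Prop :=
  forall j, t j `<=` V /\ t j !=set0.

Definition fair_over (V : set Var) (t : trajectory) : Prop :=
  forall x, V x -> forall j, exists2 k, j <= k & t k x.

Definition advance (c : assignment * trajectory) : assignment * trajectory :=
  (fun x => if x \in c.2 0 then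
              omap (fun sp : pointed_trace => (sp.1, sp.2.+1)) (c.1 x)
            else c.1 x,
   fun j => c.2 j.+1).

Fixpoint sat (c : assignment * trajectory) (f : formula AP Var) : Prop :=
  match f with
  | FTrue => True
  | FAtom a x => if c.1 x is Some (sigma, p) then sigma p a else False
  | FNot g => ~ sat c g
  | FOr g h => sat c g \/ sat c h
  | FUntil g h => exists2 i, sat (iter i advance c) h
                           & forall j, j < i -> sat (iter j advance c) g
  | FNext g => sat (advance c) g
  end.

(* LTL reading of a formula all of whose atoms carry the same trace variable:
   the variable is erased. *)
Fixpoint ltl_sat (sigma : trace AP) (p : nat) (f : formula AP Var) : Prop :=
  match f with
  | FTrue => True
  | FAtom a _ => sigma p a
  | FNot g => ~ ltl_sat sigma p g
  | FOr g h => ltl_sat sigma p g \/ ltl_sat sigma p h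
  | FUntil g h => exists2 i, ltl_sat sigma (p + i) h
                           & forall j, j < i -> ltl_sat sigma (p + j) g
  | FNext g => ltl_sat sigma p.+1 g
  end.

End TemporalSemantics.

Arguments empty_assignment {AP Var}.

Inductive ahltl (AP Var : Type) :=
| AExists of Var & ahltl AP Var
| AForall of Var & ahltl AP Var
| AE of formula AP Var
| AA of formula AP Var.

Inductive hyperltl (AP Var : Type) :=
| HExists of Var & hyperltl AP Var
| HForall of Var & hyperltl AP Var
| HBody of formula AP Var.

Section HyperSemantics.
Variables (AP : Type) (Var : eqType).

Fixpoint ahltl_sat (T : set (trace AP)) (Pi : assignment AP Var)
    (phi : ahltl AP Var) : Prop :=
  match phi with
  | AExists x phi' => exists2 sigma, T sigma & ahltl_sat T (bind Pi x sigma) phi'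
  | AForall x phi' => forall sigma, T sigma -> ahltl_sat T (bind Pi x sigma) phi'
  | AE psi => exists t, [/\ trajectory_over (dom Pi) t, fair_over (dom Pi) t
                          & sat (Pi, t) psi]
  | AA psi => forall t, trajectory_over (dom Pi) t -> fair_over (dom Pi) t ->
                sat (Pi, t) psi
  end.

Fixpoint hyperltl_sat (T : set (trace AP)) (Pi : assignment AP Var)
    (phi : hyperltl AP Var) : Prop :=
  match phi with
  | HExists x phi' =>
      exists2 sigma, T sigma & hyperltl_sat T (bind Pi x sigma) phi'
  | HForall x phi' =>
      forall sigma, T sigma -> hyperltl_sat T (bind Pi x sigma) phi'
  | HBody psi => sat (Pi, fun=> dom Pi) psi
  end.

Definition ahltl_models (K : kripke AP) (phi : ahltl AP Var) : Prop :=
  ahltl_sat (traces K) empty_assignment phi.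

Definition hyperltl_models (K : kripke AP) (phi : hyperltl AP Var) : Prop :=
  hyperltl_sat (traces K) empty_assignment phi.

Definition ahltl_exists (xs : seq Var) (phi : ahltl AP Var) : ahltl AP Var :=
  foldr (@AExists AP Var) phi xs.

Definition hyperltl_exists (xs : seq Var) (phi : hyperltl AP Var) :
    hyperltl AP Var :=
  foldr (@HExists AP Var) phi xs.

End HyperSemantics.

(* Boolean contexts with exactly one hole, which marks the occurrence of the
   phase formula; [fill C xi] is the substitution of xi for that occurrence. *)
Inductive bctx (AP Var : Type) :=
| CHole
| CNot of bctx AP Var
| COrl of bctx AP Var & formula AP Var
| COrr of formula AP Var & bctx AP Var.

Arguments CHole {AP Var}.

Fixpoint fill AP Var (C : bctx AP Var) (xi : formula AP Var) : formula AP Var :=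
  match C with
  | CHole => xi
  | CNot D => FNot (fill D xi)
  | COrl D g => FOr (fill D xi) g
  | COrr g D => FOr g (fill D xi)
  end.

Fixpoint hole_negations AP Var (C : bctx AP Var) : nat :=
  match C with
  | CHole => 0
  | CNot D => (hole_negations D).+1
  | COrl D _ | COrr _ D => hole_negations D
  end.

Definition positive AP Var (C : bctx AP Var) : bool := ~~ odd (hole_negations C).

Section Admissible.
Variables (AP : choiceType) (Var : eqType).
Implicit Types f g : formula AP Var.

Fixpoint vars f : seq Var :=
  match f with
  | FTrue => [::]
  | FAtom _ x => [:: x]
  | FNot g | FNext g => vars g
  | FOr g h | FUntil g h => vars g ++ vars h
  end.

Fixpoint state_formula f : bool :=
  match f with
  | FTrue | FAtom _ _ => true
  | FNot g => state_formula g
  | FOr g h => state_formula g && state_formula h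
  | FUntil _ _ | FNext _ => false
  end.

Definition stutter_invariant f : Prop :=
  forall sigma sigma' : trace AP, stutter_equiv sigma sigma' ->
    (ltl_sat sigma 0 f <-> ltl_sat sigma' 0 f).

Definition monadic_temporal f : Prop :=
  (exists x, {subset vars f <= [:: x]}) /\ stutter_invariant f.

Inductive phase_free : formula AP Var -> Prop :=
| PFstate f of state_formula f : phase_free f
| PFmonadic f of monadic_temporal f : phase_free f
| PFnot f of phase_free f : phase_free (FNot f)
| PFor f g of phase_free f & phase_free g : phase_free (FOr f g).

Fixpoint phase_free_ctx (C : bctx AP Var) : Prop :=
  match C with
  | CHole => True
  | CNot D => phase_free_ctx D
  | COrl D g | COrr g D => phase_free_ctx D /\ phase_free g
  end.

Definition characterization := seq (Var * Var * {fset AP}).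

Definition atomic_phase (q : Var * Var * {fset AP}) : formula AP Var :=
  let: (x, y, P) := q in
  \big[@FAnd AP Var/FTrue]_(p <- P) FIff (FAtom p x) (FAtom p y).

Definition phase_formula (Ph : characterization) : formula AP Var :=
  FAlways (\big[@FAnd AP Var/FTrue]_(q <- Ph) atomic_phase q).

Definition wf_characterization (xs : seq Var) (Ph : characterization) : Prop :=
  forall x y P, (x, y, P) \in Ph -> [/\ x \in xs, y \in xs & x != y].

(* psi is admissible over xs, and its phase formula is the one characterized by
   Ph and occurs at the hole of C. *)
Definition admissible (xs : seq Var) (psi : formula AP Var) (C : bctx AP Var)
    (Ph : characterization) : Prop :=
  [/\ psi = fill C (phase_formula Ph), phase_free_ctx C,
      wf_characterization xs Ph & {subset vars psi <= xs}].

End Admissible.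

(* The fresh proposition st is None : option AP; a proposition a of AP becomes
   Some a. *)
Section Stuttering.
Variables (AP : Type) (K : kripke AP).

(* The state s is inl s and its stuttering copy is inr s. *)
Definition st_trans (u v : state K + state K) : Prop :=
  match u, v with
  | inl s, inl s' => trans s s'
  | inl s, inr s' => s' = s
  | inr s, inr s' => s' = s
  | inr s, inl s' => trans s s'
  end.

Definition st_label (u : state K + state K) : set (option AP) :=
  match u with
  | inl s => Some @` label s
  | inr s => Some @` label s `|` [set None]
  end.

Lemma st_trans_total u : exists v, st_trans u v.
Proof. by case: u => s; exists (inr s). Qed.

Definition stuttering : kripke (option AP) :=
  @Kripke (option AP) (state K + state K)%type (inl @` @init AP K)
    st_trans st_label st_trans_total.

End Stuttering.

Fixpoint lift_formula AP Var (f : formula AP Var) : formula (option AP) Var :=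
  match f with
  | FTrue => FTrue
  | FAtom a x => FAtom (Some a) x
  | FNot g => FNot (lift_formula g)
  | FOr g h => FOr (lift_formula g) (lift_formula h)
  | FUntil g h => FUntil (lift_formula g) (lift_formula h)
  | FNext g => FNext (lift_formula g)
  end.

Fixpoint lift_ctx AP Var (C : bctx AP Var) : bctx (option AP) Var :=
  match C with
  | CHole => CHole
  | CNot D => CNot (lift_ctx D)
  | COrl D g => COrl (lift_ctx D) (lift_formula g)
  | COrr g D => COrr (lift_formula g) (lift_ctx D)
  end.

Section Translation.
Variables (AP : choiceType) (Var : eqType).
Local Notation fm := (formula (option AP) Var).

Definition st (x : Var) : fm := FAtom None x.

Definition change (P : {fset AP}) (x : Var) : fm :=
  \big[@FOr (option AP) Var/FFalse]_(p <- P)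
    FNot (FIff (FAtom (Some p) x) (FNext (FUntil (st x) (FAtom (Some p) x)))).

Definition move (x : Var) : fm := FNext (FNot (st x)).

Definition align (q : Var * Var * {fset AP}) : fm :=
  let: (x, y, P) := q in
  FAnd
    (FAnd (FImp (FAnd (move x) (move y)) (FIff (change P x) (change P y)))
          (FImp (FAnd (move x) (FNot (move y))) (FNot (change P x))))
    (FImp (FAnd (FNot (move x)) (move y)) (FNot (change P y))).

Definition phase (Ph : characterization AP Var) : fm :=
  \big[@FAnd (option AP) Var/FTrue]_(q <- Ph) align q.

Definition fair (xs : seq Var) : fm :=
  \big[@FAnd (option AP) Var/FTrue]_(x <- xs)
    FAlways (FEventually (FNot (st x))).

Definition esync (xs : seq Var) (C : bctx AP Var)
    (Ph : characterization AP Var) : fm :=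
  FAnd (fair xs)
    (fill (lift_ctx C)
       (FAnd (FAlways (phase Ph)) (lift_formula (phase_formula Ph)))).

End Translation.

(* Main.v *)
(* An asynchronous run and a synchronous run of the stuttering structure
   correspond when pi moves in a step exactly if its next synchronous state is
   not a stuttering copy.  A trajectory yields such a synchronous run directly.
   Conversely, synchronous steps in which every trace stutters have no
   asynchronous counterpart (trajectories consist of nonempty sets) and are
   dropped; fairness leaves infinitely many steps.  Dropping them changes each
   trace only up to stuttering, which monadic formulas do not see, and a [Box]
   of a state formula is unaffected because every synchronous valuation occurs
   in the asynchronous run and vice versa.  Finally [Box phase] is implied by
   the phase formula: if related traces always agree on P, a trace cannot change
   P in a step unless the other one changes it too. *)
Require Import Defs.
From mathcomp Require Import all_boot finmap boolp classical_sets.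

Set Implicit Arguments.
Unset Strict Implicit.
Unset Printing Implicit Defensive.

Local Open Scope classical_set_scope.

(** * Counting marked steps *)

(** When [b i] tells whether a pointer moves in step [i], this is the position of the pointer just
    before step [k]. *)
Definition cnt (b : nat -> bool) (k : nat) : nat := \sum_(i < k) b i.

Definition infinitely_often (b : nat -> bool) : Prop :=
  forall j, exists2 k, j <= k & b k.

Lemma cnt0 b : cnt b 0 = 0.
Proof. by rewrite /cnt big_ord0. Qed.

Lemma cntS b k : cnt b k.+1 = cnt b k + b k.
Proof. by rewrite /cnt big_ord_recr. Qed.

Lemma leq_cnt b k l : k <= l -> cnt b k <= cnt b l.
Proof.
move=> /subnKC <-; elim: (l - k) => [|d IHd]; first by rewrite addn0.
by rewrite addnS cntS (leq_trans IHd) ?leq_addr.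
Qed.

Lemma cnt_true (b : nat -> bool) k : (forall i, b i) -> cnt b k = k.
Proof. by move=> bT; elim: k => [|k IHk]; rewrite ?cnt0 // cntS IHk bT addn1. Qed.

Lemma cnt_inj_on (b : nat -> bool) k l : b k -> b l -> cnt b k = cnt b l -> k = l.
Proof.
wlog ltkl : k l / k < l => [th bk bl eq_kl|bk _ eq_kl].
  by case: (ltngtP k l) => // lt_kl; [|symmetry]; apply: th.
by have := leq_cnt b ltkl; rewrite cntS bk -eq_kl addn1 ltnn.
Qed.

(** Counts are monotone, so equal counts leave no marked step between [k] and [l], and only marked
    steps can alter [U]. *)
Lemma cnt_const T (U : nat -> T) (b : nat -> bool) k l :
  (forall i, ~~ b i -> U i.+1 = U i) -> cnt b k = cnt b l -> U k = U l.
Proof.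
move=> Ub; wlog lekl : k l / k <= l => [th|].
  by case: (leqP k l) => [|/ltnW] lekl eq_kl; [|symmetry]; apply: th.
rewrite -(subnKC lekl); elim: (l - k) => [|d IHd]; first by rewrite addn0.
rewrite addnS => eq_cnt.
have le1 := leq_cnt b (leq_addr d k).
have eq1 : cnt b k = cnt b (k + d).
  by apply/eqP; rewrite eqn_leq le1 eq_cnt leq_cnt.
rewrite IHd // Ub //; move: eq_cnt; rewrite cntS -eq1 -{1}[cnt b k]addn0.
by move/addnI; case: (b _).
Qed.

(** Going from any position to the least marked one at or after it passes only unmarked steps, which
    leave the count as it is; [g] thus enumerates the marked steps. *)
Lemma cnt_reached (b : nat -> bool) : infinitely_often b ->
  exists g : nat -> nat, forall m, b (g m) /\ cnt b (g m) = m.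
Proof.
move=> b_inf.
have next k : exists2 l, b l & cnt b l = cnt b k.
  have ex : exists l, (k <= l) && b l.
    by have [l kl bl] := b_inf k; exists l; rewrite kl.
  case: (ex_minnP ex) => l /andP[kl bl] lmin; exists l => //.
  suff H d : k + d <= l -> cnt b (k + d) = cnt b k.
    by rewrite -(subnKC kl); apply: H; rewrite subnKC.
  elim: d => [|d IHd]; first by rewrite addn0.
  rewrite addnS => ltl; rewrite cntS IHd 1?ltnW //.
  case: (boolP (b (k + d))) => [bkd|]; last by rewrite addn0.
  by have := lmin (k + d); rewrite leq_addr bkd leqNgt ltl => /(_ isT).
suff ex m : exists k, b k /\ cnt b k = m by have [g gP] := boolp.choice ex; exists g.
elim: m => [|m [k [bk <-]]].
  by have [l bl eql] := next 0; exists l; rewrite bl eql cnt0.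
by have [l bl eql] := next k.+1; exists l; rewrite bl eql cntS bk addn1.
Qed.

(** Deleting the steps outside [G] loses no step of [b]; a kept step [k] is recovered as
    [g (cnt G k)], being the only marked step with its count. *)
Lemma cnt_comp (b G : nat -> bool) (g : nat -> nat) :
  (forall i, b i -> G i) -> (forall m, G (g m) /\ cnt G (g m) = m) ->
  forall k, cnt (b \o g) (cnt G k) = cnt b k.
Proof.
move=> bG Gg; elim=> [|k IHk]; first by rewrite !cnt0.
rewrite !cntS; case: (boolP (G k)) => [Gk|nGk]; last first.
  by rewrite addn0 IHk (contraNF (bG k) nGk) addn0.
rewrite addn1 cntS IHk /=.
by rewrite (@cnt_inj_on G (g (cnt G k)) k) ?(Gg _).1 ?(Gg _).2.
Qed.

Lemma stutter_equiv_cnt AP (sigma : trace AP) G : infinitely_often G ->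
  stutter_equiv sigma (sigma \o cnt G).
Proof.
move=> /cnt_reached [g Gg].
(* For [m > 0], block [m] of the stuttered trace starts right after the marked step [g (m - 1)];
   every block ends with [g m]. On the other side the blocks are single positions. *)
pose j m := if m is m'.+1 then (g m').+1 else 0.
have hj m : cnt G (j m) = m.
  by case: m => [|m] /=; rewrite ?cnt0 // cntS (Gg m).1 (Gg m).2 addn1.
exists id, j; split; [by [] | split=> // k | move=> k l l'].
  rewrite ltnNge; apply/negP => /(leq_cnt G).
  by rewrite !hj ltnn.
rewrite ltnS -eqn_leq => /eqP <- /andP[/(leq_cnt G) le1] /=.
rewrite ltnS => /(leq_cnt G); rewrite (Gg k).2 => le2; congr sigma.
by apply/eqP; rewrite eqn_leq le2 -{1}(hj k) le1.
Qed.

(** * Paths with and without stuttering copies *)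

Section Kripke.
Variables (AP : Type) (K : kripke AP).

Definition base_state (u : state K + state K) : state K :=
  match u with inl s | inr s => s end.

Lemma st_label_Some u a : st_label u (Some a) <-> label (base_state u) a.
Proof.
case: u => s /=; split.
- by case=> b ? [<-].
- by move=> ?; exists a.
- by case=> [[b ? [<-]]|].
- by move=> ?; left; exists a.
Qed.

Lemma st_label_None (u : state K + state K) :
  st_label u None <-> if u is inr _ then True else False.
Proof. by case: u => s /=; split=> //; [case | move=> _; right]. Qed.

Lemma restutter sigma (b : nat -> bool) : traces K sigma ->
  exists2 tau, traces (stuttering K) tau &
    (forall k a, tau k (Some a) <-> sigma (cnt b k) a) /\
    (forall k, tau k.+1 None <-> ~~ b k).
Proof.
case=> s [s0 sS] ->.
(* A moving step enters an original state, any other step the stuttering copy of the current one.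
   Position 0 must be original, since only original states are initial. *)
pose u k := if k is k'.+1
  then if b k' then inl (s (cnt b k)) else inr (s (cnt b k)) else inl (s 0).
have uE k : base_state (u k) = s (cnt b k).
  by case: k => [|k] /=; [rewrite cnt0 | case: (b k)].
exists (fun k => st_label (u k)).
  exists u => //; split; first by exists (s 0).
  move=> k; have := uE k.
  rewrite [u k.+1]/= cntS; case: (b k); case: (u k) => v /= ->;
    by rewrite ?addn1 ?addn0.
split=> [k a|k]; first by rewrite st_label_Some uE.
by rewrite st_label_None /=; case: (b k).
Qed.

Lemma unstutter tau : traces (stuttering K) tau ->
  infinitely_often (fun k => `[< ~ tau k.+1 None >]) ->
  exists2 sigma, traces K sigma &
    forall k a,
      tau k (Some a) <-> sigma (cnt (fun i => `[< ~ tau i.+1 None >]) k) a.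
Proof.
case=> u [u0 uS] ->; set G := (fun _ => _) => /cnt_reached[g Gg].
(* A marked step enters an original state, hence follows [trans]; any other enters a copy of the
   base state that it leaves. *)
have uG k : if G k then trans (base_state (u k)) (base_state (u k.+1))
            else base_state (u k.+1) = base_state (u k).
  have -> : G k = if u k.+1 is inl _ then true else false.
    apply/asboolP/idP => /=; rewrite st_label_None; case: (u k.+1) => s //=;
      by move=> _ [].
  by have := uS k; case: (u k) (u k.+1) => [v|v] [w|w].
have uconst k l : cnt G k = cnt G l -> base_state (u k) = base_state (u l).
  by apply: (cnt_const (U := base_state \o u)) => i /negbTE Gi; move: (uG i); rewrite Gi.
(* Sampling at the source [g m] of each marked step, not at its target, makes sample 0 the initial
   state: the base state is constant up to [g 0]. *)
exists (fun m => label (base_state (u (g m)))).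
  exists (fun m => base_state (u (g m))) => //; split.
    rewrite (uconst _ 0) ?(Gg 0).2 ?cnt0 //.
    by case: u0 => s ? <-.
  move=> m; have := uG (g m); rewrite (Gg m).1.
  by rewrite (uconst (g m).+1 (g m.+1)) // cntS (Gg m).1 !(Gg _).2 addn1.
move=> k a; rewrite /= st_label_Some.
by rewrite (uconst k (g (cnt G k))) // (Gg _).2.
Qed.

End Kripke.

(** * Connectives, iterated steps and quantifier prefixes *)

Section Semantics.
Variables (AP : Type) (Var : eqType).
Implicit Types (c : assignment AP Var * trajectory Var) (f g : formula AP Var).

Definition assign (xs : seq Var) (Sigma : Var -> trace AP) : assignment AP Var :=
  fun x => if x \in xs then Some (Sigma x, 0) else None.

Lemma sat_FAnd c f g : sat c (FAnd f g) <-> sat c f /\ sat c g.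
Proof.
split=> /= [/not_orP[/contrapT ? /contrapT ?]//|[? ?] [|]//].
Qed.

Lemma sat_FImp c f g : sat c (FImp f g) <-> (sat c f -> sat c g).
Proof. by rewrite /= implyE. Qed.

Lemma sat_FIff c f g : sat c (FIff f g) <-> (sat c f <-> sat c g).
Proof. by rewrite sat_FAnd !sat_FImp. Qed.

Lemma sat_FAlways c f : sat c (FAlways f) <-> forall k, sat (iter k (@advance AP Var) c) f.
Proof.
split=> /= [H k|H [k nk _]]; last exact: nk (H k).
by apply: contrapT => nk; apply: H; exists k.
Qed.

Lemma sat_FEventually c f :
  sat c (FEventually f) <-> exists k, sat (iter k (@advance AP Var) c) f.
Proof. by split=> /= [[k]|[k]]; exists k. Qed.

Lemma sat_big_FAnd (I : eqType) c (s : seq I) (F : I -> formula AP Var) :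
  sat c (\big[@FAnd AP Var/FTrue]_(i <- s) F i) <->
  forall i, i \in s -> sat c (F i).
Proof.
elim: s => [|i s IHs]; first by rewrite big_nil.
rewrite big_cons sat_FAnd IHs; split=> [[Fi Fs] j|H].
  by rewrite inE => /predU1P[->|/Fs].
by split=> [|j js]; apply: H; rewrite inE ?eqxx ?js ?orbT.
Qed.

Lemma sat_big_FOr (I : eqType) c (s : seq I) (F : I -> formula AP Var) :
  sat c (\big[@FOr AP Var/FFalse]_(i <- s) F i) <->
  exists2 i, i \in s & sat c (F i).
Proof.
elim: s => [|i s IHs]; first by rewrite big_nil; split=> [/(_ Logic.I)|[]].
rewrite big_cons /= IHs; split=> [[Fi|[j js Fj]]|[j]].
- by exists i; rewrite ?inE ?eqxx.
- by exists j; rewrite ?inE ?js ?orbT.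
- by rewrite inE => /predU1P[->|js Fj]; [left | right; exists j].
Qed.

(** Pointers move independently of each other, so questions about positions become arithmetic of
    [cnt]. *)
Lemma iter_advance k (Pi : assignment AP Var) t :
  iter k (@advance AP Var) (Pi, t) =
  (fun x => omap (fun sp : pointed_trace AP =>
                    (sp.1, sp.2 + cnt (fun i => x \in t i) k)) (Pi x),
   fun j => t (k + j)).
Proof.
elim: k => [|k IHk].
  congr pair; apply/funext => x.
  by case: (Pi x) => //= -[s p]; rewrite cnt0 addn0.
rewrite iterS IHk /advance /=; congr pair; apply/funext => x; last first.
  by rewrite addnS addSn.
rewrite addn0 cntS; case: (Pi x) => [[s p]|]; case: (x \in t k) => //=.
  by rewrite addn1 addnS.
by rewrite addn0.
Qed.

Lemma sat_iter_atom xs Sigma t k a x :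
  sat (iter k (@advance AP Var) (assign xs Sigma, t)) (FAtom a x) <->
  x \in xs /\ Sigma x (cnt (fun i => x \in t i) k) a.
Proof.
rewrite iter_advance /= /assign; case: ifP => [_|] /=; last by split=> // -[].
by rewrite add0n; split=> // -[].
Qed.

Lemma dom_assign xs Sigma : dom (assign xs Sigma) = [set x | x \in xs].
Proof.
by apply/funext => x; apply/propext; rewrite /dom /assign /=; case: ifP.
Qed.

(** Abstracting over [F] lets the asynchronous and the synchronous prefix share one argument. *)
Lemma bind_assign_exists (T : set (trace AP)) (xs : seq Var)
    (F : assignment AP Var -> Prop) Pi :
  foldr (fun x G Pi => exists2 sigma, T sigma & G (bind Pi x sigma)) F xs Pi <->
  exists2 Sigma : Var -> trace AP, (forall x, x \in xs -> T (Sigma x)) &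
    F (fun y => if y \in xs then Some (Sigma y, 0) else Pi y).
Proof.
elim: xs Pi => [|x xs IHxs] Pi /=.
  by split=> [FPi|[]//]; exists (fun=> fun=> set0).
split=> [[sigma Ts /IHxs[Sigma TS FS]]|[Sigma TS FS]].
  (* If [x] occurs again in [xs], the inner binding overrides the outer one, so [sigma] is used only
     outside [xs]. *)
  exists (fun y => if y \in xs then Sigma y else sigma) => [y|].
    by rewrite inE; case: ifP => [/TS//|_ _].
  congr F: FS; apply/funext => y; rewrite inE /bind.
  by case: (y \in xs); rewrite ?orbT ?orbF.
exists (Sigma x); first by apply: TS; rewrite inE eqxx.
apply/IHxs; exists Sigma => [y ys|].
  by apply: TS; rewrite inE ys orbT.
congr F: FS; apply/funext => y; rewrite inE /bind.
by case: (y \in xs); rewrite ?orbT ?orbF //; case: eqP => // ->.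
Qed.

Lemma ahltl_existsP T xs psi :
  ahltl_sat T (@empty_assignment AP Var) (ahltl_exists xs (AE psi)) <->
  exists2 Sigma, (forall x, x \in xs -> T (Sigma x)) &
    ahltl_sat T (assign xs Sigma) (AE psi).
Proof.
apply: iff_trans (bind_assign_exists T xs (fun Pi => ahltl_sat T Pi (AE psi)) empty_assignment).
elim: xs empty_assignment => //= x xs IHxs Pi.
by split=> -[sigma Ts /IHxs]; exists sigma.
Qed.

Lemma hyperltl_existsP T xs psi :
  hyperltl_sat T (@empty_assignment AP Var) (hyperltl_exists xs (HBody psi)) <->
  exists2 Sigma, (forall x, x \in xs -> T (Sigma x)) &
    sat (assign xs Sigma, fun=> [set x | x \in xs]) psi.
Proof.
rewrite (_ : (exists2 _, _ & _) <-> exists2 Sigma : Var -> trace AP,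
    forall x, x \in xs -> T (Sigma x) &
    hyperltl_sat T (assign xs Sigma) (HBody psi)); last first.
  by split=> -[Sigma TS H]; exists Sigma => //; move: H; rewrite /= dom_assign.
apply: iff_trans (bind_assign_exists T xs (fun Pi => hyperltl_sat T Pi (HBody psi)) empty_assignment).
elim: xs empty_assignment => //= x xs IHxs Pi.
by split=> -[sigma Ts /IHxs]; exists sigma.
Qed.

End Semantics.

(** * Single-variable formulas, lifting and Boolean contexts *)

Section Admissible.
Variables (AP : choiceType) (Var : eqType).
Implicit Types (c : assignment AP Var * trajectory Var) (f g : formula AP Var).

(** A formula about [x] alone sees the run only through the atoms of [x]. Collecting those true
    after [l] steps gives a trace to which stuttering invariance applies. *)
Lemma sat_ltl c f x : all (pred1 x) (vars f) -> forall k,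
  sat (iter k (@advance AP Var) c) f <->
  ltl_sat (fun l => [set a | sat (iter l (@advance AP Var) c) (FAtom a x)]) k f.
Proof.
elim: f => [|a y|f IHf|f IHf g IHg|f IHf g IHg|f IHf] //=.
- by rewrite andbT => /eqP ->.
- by move=> fx k; rewrite IHf.
- by rewrite all_cat => /andP[fx gx] k; rewrite IHf // IHg.
- rewrite all_cat => /andP[/IHf{}IHf /IHg{}IHg] k.
  split=> -[i gi fi]; exists i.
  + by rewrite -IHg addnC iterD.
  + by move=> j /fi; rewrite -IHf addnC iterD.
  + by rewrite -iterD addnC IHg.
  + by move=> j /fi; rewrite -iterD addnC IHf.
- by move=> fx k; rewrite -iterS IHf.
Qed.

Lemma ltl_lift (tau : trace (option AP)) f k :
  ltl_sat tau k (lift_formula f) <->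
  ltl_sat (fun l => [set a | tau l (Some a)]) k f.
Proof.
elim: f k => [|a y|f IHf|f IHf g IHg|f IHf g IHg|f IHf] k //=.
- by rewrite IHf.
- by rewrite IHf IHg.
- by split=> -[i /IHg gi fi]; exists i => // j /fi /IHf.
Qed.

Lemma vars_lift f : vars (lift_formula f) = vars f.
Proof. by elim: f => //= f -> // g ->. Qed.

Lemma sat_state_lift c (c' : assignment (option AP) Var * trajectory Var) f :
  (forall a x, sat c (FAtom a x) <-> sat c' (FAtom (Some a) x)) ->
  state_formula f -> sat c f <-> sat c' (lift_formula f).
Proof.
move=> cc'; elim: f => [|a y|f IHf|f IHf g IHg|f IHf g IHg|f IHf] //.
- by move=> /= /IHf ->.
- by move=> /= /andP[/IHf -> /IHg ->].
Qed.

Lemma sat_fill c (c' : assignment (option AP) Var * trajectory Var)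
    (C : bctx AP Var) xi xi' :
  (forall g, phase_free g -> sat c g <-> sat c' (lift_formula g)) ->
  phase_free_ctx C -> (sat c xi <-> sat c' xi') ->
  sat c (fill C xi) <-> sat c' (fill (lift_ctx C) xi').
Proof.
move=> free + xixi'; elim: C => [|D IHD|D IHD g|g D IHD] //=.
- by move=> /IHD ->.
- by move=> [/IHD -> /free ->].
- by move=> [/IHD -> /free ->].
Qed.

End Admissible.

(** * The synchronous formulas [fair], [change] and [phase] *)

Section Translation.
Variables (AP : choiceType) (Var : eqType) (xs : seq Var).
Variables (tau : Var -> trace (option AP)).
Local Notation step k :=
  (iter k (@advance (option AP) Var) (assign xs tau, fun=> [set x | x \in xs])).

Lemma sat_sync_atom k a x :
  sat (step k) (FAtom a x) <-> x \in xs /\ tau x k a.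
Proof.
rewrite sat_iter_atom; split=> -[xxs]; rewrite cnt_true // => _;
  by rewrite inE.
Qed.

Lemma sat_fair : sat (step 0) (fair AP xs) <->
  forall x, x \in xs -> infinitely_often (fun k => `[< ~ tau x k.+1 None >]).
Proof.
rewrite sat_big_FAnd; split=> H x xxs.
  (* Starting at [j.+1] makes the position found a successor, as moves are read off the label at
     [k.+1]. *)
  move=> j; have /sat_FAlways/(_ j.+1)/sat_FEventually[k] := H x xxs.
  rewrite -iterD -iterD addn0 => nst; exists (k + j); first exact: leq_addl.
  apply/asboolP => st; apply: nst; apply/sat_sync_atom.
  by rewrite addnS.
apply/sat_FAlways => j; apply/sat_FEventually.
have [k jk /asboolP nst] := H x xxs j; exists (k.+1 - j).
rewrite -iterD -iterD addn0 subnK 1?leqW // => /sat_sync_atom[].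
by move=> _ /nst.
Qed.

Hypothesis tau_stutter : forall x k a, x \in xs ->
  tau x k.+1 None -> tau x k.+1 (Some a) <-> tau x k (Some a).

Lemma sat_move k x : sat (step k) (move AP x) <-> ~ (x \in xs /\ tau x k.+1 None).
Proof. by rewrite -sat_sync_atom. Qed.

(** After a move [st] is false at the next position, so the until can hold there only with zero
    delay and reduces to the next value of [p]. *)
Lemma sat_change k P x : sat (step k) (move AP x) ->
  sat (step k) (change P x) <->
  exists2 p, p \in P & ~ (sat (step k) (FAtom (Some p) x) <->
                          sat (step k.+1) (FAtom (Some p) x)).
Proof.
move=> mv; rewrite sat_big_FOr.
suff E p : sat (step k) (FNext (FUntil (st AP x) (FAtom (Some p) x))) <->
           sat (step k.+1) (FAtom (Some p) x).
  split=> -[p pP H]; exists p => //.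
    by rewrite -E => /sat_FIff.
  by move=> /sat_FIff; rewrite E.
split=> [[[|i] // _ /(_ 0 isT)] | H]; last by exists 0.
by move=> stx; case: mv.
Qed.

Lemma sat_stay k p x : ~ sat (step k) (move AP x) ->
  sat (step k) (FAtom (Some p) x) <-> sat (step k.+1) (FAtom (Some p) x).
Proof.
rewrite sat_move => /contrapT[xxs stx].
by rewrite !sat_sync_atom tau_stutter.
Qed.

(** If both traces move, agreement now and at the next position makes them change together. If one
    stays, its atoms are frozen, and the moving one must keep [P] to go on agreeing. *)
Lemma sat_always_phase (Ph : characterization AP Var) :
  (forall k x y P p, (x, y, P) \in Ph -> p \in P ->
     sat (step k) (FAtom (Some p) x) <-> sat (step k) (FAtom (Some p) y)) ->
  sat (step 0) (FAlways (phase Ph)).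
Proof.
move=> agree; apply/sat_FAlways => k; rewrite -iterD addn0.
apply/sat_big_FAnd => -[[x y] P] xyP.
apply/sat_FAnd; split; first (apply/sat_FAnd; split); apply/sat_FImp => /sat_FAnd.
- move=> [mx my]; rewrite sat_FIff !sat_change //.
  by split=> -[p pP np]; exists p => //; move: np; rewrite !(agree _ x y P p).
- move=> [mx /sat_stay sy] /(sat_change _ mx)[p pP []].
  by rewrite !(agree _ x y P p) // sy.
- move=> [/sat_stay sx my] /(sat_change _ my)[p pP []].
  by rewrite -!(agree _ x y P p) // sx.
Qed.

End Translation.

(** * Transfer between matched runs *)

Section Simulation.
Variables (AP : choiceType) (Var : eqType) (xs : seq Var).
Variables (Sigma : Var -> trace AP) (t : trajectory Var).
Variables (tau : Var -> trace (option AP)) (G : nat -> bool).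
Local Notation async k := (iter k (@advance AP Var) (assign xs Sigma, t)).
Local Notation sync k :=
  (iter k (@advance (option AP) Var) (assign xs tau, fun=> [set x | x \in xs])).

(* Synchronous position k is matched with asynchronous position [cnt G k]: G
   marks the synchronous steps that are not dropped. *)
Hypothesis G_inf : infinitely_often G.
Hypothesis tauE : forall x k a, x \in xs ->
  tau x k (Some a) <-> Sigma x (cnt (fun i => x \in t i) (cnt G k)) a.

Lemma async_sync_atom k a x :
  sat (async (cnt G k)) (FAtom a x) <-> sat (sync k) (FAtom (Some a) x).
Proof.
rewrite sat_sync_atom sat_iter_atom.
by split=> -[xxs]; rewrite tauE.
Qed.

(** In the monadic case the synchronous letters of [x] are the asynchronous ones composed with
    [cnt G], a stuttering of the same trace. *)
Lemma async_sync_phase_free f : phase_free f ->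
  sat (async 0) f <-> sat (sync 0) (lift_formula f).
Proof.
elim=> {f} [f sf|f [[x sub] inv]|f _ IHf|f g _ IHf _ IHg].
- apply: sat_state_lift sf => a x.
  by rewrite -(async_sync_atom 0) cnt0.
- have fx : all (pred1 x) (vars f).
    by apply/allP => y /sub; rewrite inE.
  rewrite (sat_ltl _ fx 0) (@sat_ltl _ _ _ (lift_formula f) x _ 0) ?vars_lift //.
  rewrite ltl_lift (inv _ _ (stutter_equiv_cnt _ G_inf)).
  rewrite (_ : _ \o _ = fun l => [set a | sat (sync l) (FAtom (Some a) x)]) //.
  apply/funext => l; apply/funext => a; apply/propext.
  exact: async_sync_atom.
- by move: IHf => /= ->.
- by move: IHf IHg => /= -> ->.
Qed.

(** Matched positions satisfy the same state formulas, and [cnt G] is onto, so no asynchronous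
    position is missed. *)
Lemma async_sync_always f : state_formula f ->
  sat (async 0) (FAlways f) <-> sat (sync 0) (lift_formula (FAlways f)).
Proof.
move=> sf; rewrite (sat_FAlways (async 0)) (sat_FAlways (sync 0)).
have E k : sat (async (cnt G k)) f <-> sat (sync k) (lift_formula f).
  by apply: sat_state_lift => // a x; apply: async_sync_atom.
have [g Gg] := cnt_reached G_inf.
split=> H k; first by rewrite -iterD addn0 -E -(addn0 (cnt _ _)) iterD.
by rewrite -iterD addn0 -(Gg k).2 E -(addn0 (g k)) iterD.
Qed.

Lemma state_formula_phase (Ph : characterization AP Var) :
  state_formula (\big[@FAnd AP Var/FTrue]_(q <- Ph) atomic_phase q).
Proof.
have FAnd_state (f g : formula AP Var) :
  state_formula f -> state_formula g -> state_formula (FAnd f g).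
  by move=> /= -> ->.
apply: (big_ind (fun f => state_formula f)) => // -[[x y] P] _.
exact: (big_ind (fun f => state_formula f)).
Qed.

Hypothesis tau_stutter : forall x k a, x \in xs ->
  tau x k.+1 None -> tau x k.+1 (Some a) <-> tau x k (Some a).

Lemma async_sync_phase Ph :
  sat (async 0) (phase_formula Ph) <->
  sat (sync 0) (FAnd (FAlways (phase Ph)) (lift_formula (phase_formula Ph))).
Proof.
rewrite sat_FAnd -async_sync_always ?state_formula_phase //.
split=> [H|[]//]; split=> //; apply: sat_always_phase => // k x y P p xyP pP.
(* Agreement at synchronous position [k] is the phase formula at asynchronous position [cnt G k]. *)
rewrite -!async_sync_atom.
have /sat_FAlways/(_ (cnt G k))/sat_big_FAnd/(_ _ xyP) := H.
rewrite -iterD addn0 => /sat_big_FAnd/(_ _ pP).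
by rewrite sat_FIff.
Qed.

Lemma async_sync_fill C Ph : phase_free_ctx C ->
  sat (async 0) (fill C (phase_formula Ph)) <->
  sat (sync 0) (fill (lift_ctx C)
    (FAnd (FAlways (phase Ph)) (lift_formula (phase_formula Ph)))).
Proof.
move=> freeC; apply: sat_fill freeC _; last exact: async_sync_phase.
exact: async_sync_phase_free.
Qed.

End Simulation.

(** * The two directions of the equivalence *)

Theorem theorem2 (AP : choiceType) (Var : eqType) (K : kripke AP)
    (n : nat) (pis : n.-tuple Var) (psi : formula AP Var)
    (C : bctx AP Var) (Ph : characterization AP Var) :
  0 < n ->
  admissible pis psi C Ph ->
  positive C ->
  ahltl_models K (ahltl_exists pis (AE psi)) <->
  hyperltl_models (stuttering K) (hyperltl_exists pis (HBody (esync pis C Ph))).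
Proof.
move=> n_gt0 [-> freeC _ _] _.
rewrite /ahltl_models /hyperltl_models ahltl_existsP hyperltl_existsP.
split=> [[Sigma TS [t [t_over t_fair sat_psi]]]|[tau Ttau]].
  rewrite dom_assign in t_over t_fair.
  have ex x : exists tau : trace (option AP), x \in pis ->
      [/\ traces (stuttering K) tau,
          forall k a, tau k (Some a) <-> Sigma x (cnt (fun i => x \in t i) k) a
        & forall k, tau k.+1 None <-> x \notin t k].
    case: (boolP (x \in pis)) => [/TS Tx|_]; last by exists (fun=> set0).
    by have [tau ? []] := restutter (fun i => x \in t i) Tx; exists tau.
  have [tau tauP] := boolp.choice ex; exists tau => [x /tauP[]//|].
  apply/sat_FAnd; split.
    apply/sat_fair => x xpis j; have [k jk tkx] := t_fair x xpis j.
    exists k => //; apply/asboolP; case: (tauP x xpis) => _ _ -> /negP; apply.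
    by rewrite inE.
  (* No step is dropped in this direction, so [cnt G k] is [k]. *)
  apply/(async_sync_fill (G := predT) (Sigma := Sigma) (t := t)) => //.
  - by move=> j; exists j.
  - by move=> x k a /tauP[_ -> _]; rewrite (@cnt_true predT).
  - move=> x k a /tauP[_ tauE ->] /negbTE stx.
    by rewrite !tauE cntS stx addn0.
move=> /sat_FAnd[/sat_fair tau_fair sat_psi].
pose b x k := `[< ~ tau x k.+1 None >].
have ex x : exists sigma : trace AP, x \in pis -> traces K sigma /\
    forall k a, tau x k (Some a) <-> sigma (cnt (b x) k) a.
  case: (boolP (x \in pis)) => [xpis|_]; last by exists (fun=> set0).
  by have [sigma ? ?] := unstutter (Ttau x xpis) (tau_fair x xpis); exists sigma.
have [Sigma SigmaP] := boolp.choice ex.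
exists Sigma => [x /SigmaP[]//|].
(* A step is kept when some variable moves in it. *)
pose G k := has (fun x => b x k) pis.
have bG x k : x \in pis -> b x k -> G k by move=> xpis bxk; apply/hasP; exists x.
have G_inf : infinitely_often G.
  (* Positivity of [n] supplies a variable, whose fairness yields infinitely many kept steps. *)
  have xpis := mem_tnth (Ordinal n_gt0) pis.
  by move=> j; have [k jk /(bG _ _ xpis)] := tau_fair _ xpis j; exists k.
have [g Gg] := cnt_reached G_inf.
pose t m := [set x | x \in pis /\ b x (g m)].
have t_in x : x \in pis -> (fun i => x \in t i) = b x \o g.
  move=> xpis; apply/funext => i; apply/idP/idP; first by rewrite inE => -[].
  by rewrite inE.
exists t; rewrite dom_assign; split.
- move=> m; split=> [x []//|].
  by have /hasP[x ? ?] := (Gg m).1; exists x.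
(* Searching from [g j] puts the trajectory index [cnt G k] at or beyond [cnt G (g j) = j]; as [k]
   is kept, [g] sends that index back to [k]. *)
- move=> x xpis j; have [k jk bxk] := tau_fair x xpis (g j).
  exists (cnt G k); first by rewrite -(Gg j).2 leq_cnt.
  split=> //; rewrite (@cnt_inj_on G (g (cnt G k)) k) ?(Gg _).1 ?(Gg _).2 //.
  exact: bG bxk.
- apply/(async_sync_fill (G := G) (tau := tau)) => //.
    (* Dropping steps in which no variable moves leaves every pointer where it was. *)
    move=> x k a xpis; rewrite t_in // (cnt_comp _ Gg) => [|i]; last exact: bG.
    exact: (SigmaP x xpis).2.
  move=> x k a xpis stx; rewrite !(SigmaP x xpis).2 cntS.
  by rewrite {2}/b; case: asboolP => // _; rewrite addn0.
Qed.
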